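(* There exist a quasitree $X$, finite graphs $X_1$ and $X_2$, and covering maps $X\to X_1$ and $X\to X_2$, with $X\to X_2$ regular, for which there is no finite graph $\hat{X}$ admitting covering maps $X\to\hat{X}$, $\hat{X}\to X_1$ and $\hat{X}\to X_2$. (Arbitrary coverings $X\to\hat X\to X_i$ are excluded, not only those whose compositions are the original coverings $X\to X_i$.)
   Context: Graphs are 1-dimensional cell complexes (loops and multiple edges are allowed), metrized so that each edge has length $1$. A graph is finite if it has finitely many vertices and edges. Morphisms of graphs map vertices to vertices and restrict to local isometries on edges; in particular, covering maps between graphs are morphisms of this kind. A covering is regular if its group of deck transformations acts transitively on each fibre. A quasitree is a connected, locally finite graph that is quasi-isometric to a tree. *)

(* Defs.v *)
From mathcomp Require Import all_boot.
From mathcomp Require Import boolp classical_sets functions cardinality.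
Set Implicit Arguments.
Unset Strict Implicit.
Unset Printing Implicit Defensive.

Local Open Scope classical_set_scope.

(* Combinatorial (Serre) form of a 1-dimensional cell complex: an edge of the
   complex is a pair {e, rev e} of opposite darts.  A loop is an edge with
   src e = src (rev e); it still consists of two distinct darts. *)
Record graph : Type := Graph {
  vert : Type;
  dart : Type;
  src : dart -> vert;
  rev : dart -> dart;
  revK : forall e, rev (rev e) = e;
  rev_neq : forall e, rev e <> e }.

Definition tgt (G : graph) (e : dart G) : vert G := src (rev e).

Definition star (G : graph) (v : vert G) : set (dart G) := [set e | src e = v].

Definition finite_graph (G : graph) : Prop :=
  finite_set [set: vert G] /\ finite_set [set: dart G].

Definition locally_finite (G : graph) : Prop :=
  forall v : vert G, finite_set (star v).

(* A map sending vertices to vertices that is a local isometry on each edge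
   carries every edge isometrically onto an edge, hence is given by its values
   on vertices and darts. *)
Record hom (G H : graph) : Type := Hom {
  vmap : vert G -> vert H;
  dmap : dart G -> dart H;
  dmap_src : forall e, src (dmap e) = vmap (src e);
  dmap_rev : forall e, dmap (rev e) = rev (dmap e) }.

Definition covering (G H : graph) (p : hom G H) : Prop :=
  set_surj [set: vert G] [set: vert H] (vmap p) /\
  forall v : vert G, set_bij (star v) (star (vmap p v)) (dmap p).

Definition automorphism (G : graph) (f : hom G G) : Prop :=
  bijective (vmap f) /\ bijective (dmap f).

Definition deck (G H : graph) (p : hom G H) (f : hom G G) : Prop :=
  [/\ automorphism f,
      forall v, vmap p (vmap f v) = vmap p v &
      forall e, dmap p (dmap f e) = dmap p e].

(* The second conjunct concerns the fibres over interior points of edges. *)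
Definition regular (G H : graph) (p : hom G H) : Prop :=
  (forall x y : vert G, vmap p x = vmap p y ->
     exists2 f, deck p f & vmap f x = y) /\
  (forall a b : dart G, dmap p a = dmap p b ->
     exists2 f, deck p f & dmap f a = b).

Fixpoint walk (G : graph) (u : vert G) (s : seq (dart G)) (v : vert G) : Prop :=
  if s is e :: s' then src e = u /\ walk (tgt e) s' v else u = v.

Definition connected (G : graph) : Prop :=
  inhabited (vert G) /\ forall u v : vert G, exists s, walk u s v.

Definition reduced (G : graph) (s : seq (dart G)) : Prop :=
  forall s1 e s2, s <> s1 ++ [:: e, rev e & s2].

Definition tree (G : graph) : Prop :=
  connected G /\
  forall (v : vert G) (s : seq (dart G)), walk v s v -> reduced s -> s = [::].

Definition is_dist (G : graph) (u v : vert G) (n : nat) : Prop :=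
  (exists2 s, walk u s v & size s = n) /\
  forall s, walk u s v -> n <= size s.

(* Path metric on the vertices; the value 0 for vertices in different
   components is junk, and is not used below. *)
Definition dist (G : graph) (u v : vert G) : nat := xget 0 (is_dist u v).

(* The vertex set is isometrically embedded and 1/2-dense in the metrized cell
   complex, so quasi-isometries are taken between vertex sets; the constants
   may be rounded up to integers.  The lower bound is the usual
   K^-1 * dist u v - C <= dist (f u) (f v), cleared of its denominator. *)
Definition quasi_isometry (G H : graph) (f : vert G -> vert H) : Prop :=
  exists K C : nat,
    [/\ 1 <= K,
        forall u v, dist (f u) (f v) <= K * dist u v + C,
        forall u v, dist u v <= K * (dist (f u) (f v) + C) &
        forall w, exists v, dist (f v) w <= C].

Definition quasi_isometric (G H : graph) : Prop :=
  exists f : vert G -> vert H, quasi_isometry f.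

Definition quasitree (G : graph) : Prop :=
  [/\ connected G, locally_finite G &
      exists T : graph, tree T /\ quasi_isometric G T].

(* Main.v *)
(* Write X for the tree of heptagons: the cubic graph in which every vertex lies
   on one heptagon and one bridge, and collapsing the heptagons yields the
   7-regular tree.  X is the Cayley graph of Z/7 * Z/2, so it covers the
   heptagonal prism X2 regularly.  The only closed reduced 7-walks of X2 are its
   two heptagons, so every covering X -> X2 maps heptagons to heptagons; hence if
   X -> Y -> X2 are coverings, the lifts to Y of the heptagons of X2 are closed.
   The graph X1 below has six vertices.  Each of its darts leaves some closed
   reduced 7-walk, as the third dart at a vertex of that walk; so a covering
   X -> X1 can be built outwards, one heptagon at a time.  On the other hand X1
   carries weights on its darts for which every closed reduced 7-walk has more
   weight on the darts leaving it than on their inverses.  If Y is a finite common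
   quotient, summing over the heptagons of Y gives a contradiction, since
   inversion permutes the darts of Y that leave a heptagon. *)

Require Import Defs.
From HB Require Import structures.
From mathcomp Require Import all_boot.
From mathcomp Require Import boolp classical_sets functions cardinality.
Set Implicit Arguments.
Unset Strict Implicit.
Unset Printing Implicit Defensive.

Local Open Scope classical_set_scope.

(** * Cubic graphs *)

Definition slot : Type := option bool.

Record cubic : Type := Cubic {
  cvert :> Type;
  flip : cvert * slot -> cvert * slot;
  flipK : forall d, flip (flip d) = d;
  flip_neq : forall d, flip d <> d }.

Definition cgraph (c : cubic) : graph :=
  @Graph c (c * slot)%type fst (@flip c) (@flipK c) (@flip_neq c).

(* [turn true] and [turn false] give the two other darts with the same source. *)
Definition turn (V : Type) (t : bool) (d : V * slot) : V * slot :=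
  (d.1, if d.2 is Some s then (if t then Some (~~ s) else None) else Some t).

Arguments turn : simpl never.

Lemma turnP (V : Type) (a b c : V * slot) :
  a.1 = b.1 -> b.1 = c.1 -> a <> b -> a <> c -> b <> c ->
  exists t, b = turn t a /\ c = turn (~~ t) a.
Proof.
case: a b c => [x [[]|]] [_ [[]|]] [_ [[]|]] /= <- <- ab ac bc //;
  by [exists true | exists false].
Qed.

Section Run.
Variable c : cubic.
Implicit Types (d : c * slot) (ts : seq bool).

(** A reduced walk in a cubic graph is an initial dart with a choice of turn at each vertex; [outs]
    collects the third dart at each turn. With [run d ts = d] the closed walk is also reduced at its
    base point. *)
Fixpoint run d ts : c * slot :=
  if ts is t :: ts' then run (turn t (flip d)) ts' else d.

Fixpoint outs d ts : seq (c * slot) :=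
  if ts is t :: ts' then
    turn (~~ t) (flip d) :: outs (turn t (flip d)) ts' else [::].

End Run.

Fixpoint all_turns (n : nat) (P : seq bool -> bool) : bool :=
  if n is n'.+1 then
    all_turns n' (fun ts => P (true :: ts)) && all_turns n' (fun ts => P (false :: ts))
  else P [::].

Lemma all_turnsP n (P : seq bool -> bool) :
  all_turns n P -> forall ts, size ts = n -> P ts.
Proof.
elim: n P => [|n IHn] P /=; first by move=> ? [].
case/andP=> Pt Pf [|[] ts] //= [] sz_ts; first exact: (IHn _ Pt).
exact: (IHn _ Pf).
Qed.

Fixpoint has_turns (n : nat) (P : seq bool -> bool) : bool :=
  if n is n'.+1 then
    has_turns n' (fun ts => P (true :: ts)) || has_turns n' (fun ts => P (false :: ts))
  else P [::].

Lemma has_turnsP n (P : seq bool -> bool) :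
  has_turns n P -> exists2 ts, size ts = n & P ts.
Proof.
elim: n P => [|n IHn] P /=; first by exists [::].
by case/orP=> /IHn[ts sz_ts Pts]; [exists (true :: ts)|exists (false :: ts)] => //=;
  rewrite sz_ts.
Qed.

(** * The base graphs *)

Inductive letter : Type := a1 | a2 | a3 | a4 | a5 | a6.

(* [pos] stands for Z/7, with 0 written [None]: a heptagon of the tree is attached
   to its parent at [None] and to its children at the nonzero positions. *)
Definition pos : Type := option letter.

Definition idx (i : pos) : nat :=
  match i with
  | None => 0 | Some a1 => 1 | Some a2 => 2 | Some a3 => 3
  | Some a4 => 4 | Some a5 => 5 | Some a6 => 6
  end.

Definition pos_next (i : pos) : pos :=
  match i with
  | None => Some a1 | Some a1 => Some a2 | Some a2 => Some a3 | Some a3 => Some a4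
  | Some a4 => Some a5 | Some a5 => Some a6 | Some a6 => None
  end.

Definition pos_prev (i : pos) : pos :=
  match i with
  | None => Some a6 | Some a1 => None | Some a2 => Some a1 | Some a3 => Some a2
  | Some a4 => Some a3 | Some a5 => Some a4 | Some a6 => Some a5
  end.

Lemma pos_nextK : cancel pos_next pos_prev.
Proof. by case=> [[]|]. Qed.

Lemma pos_prevK : cancel pos_prev pos_next.
Proof. by case=> [[]|]. Qed.

Definition pos_step (t : bool) : pos -> pos := if t then pos_prev else pos_next.

Definition letter_code (l : letter) : bool * option bool :=
  match l with
  | a1 => (true, Some true) | a2 => (true, Some false) | a3 => (true, None)
  | a4 => (false, Some true) | a5 => (false, Some false) | a6 => (false, None)
  end.

Definition letter_decode (x : bool * option bool) : letter :=
  match x with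
  | (true, Some true) => a1 | (true, Some false) => a2 | (true, None) => a3
  | (false, Some true) => a4 | (false, Some false) => a5 | (false, None) => a6
  end.

Lemma letter_codeK : cancel letter_code letter_decode.
Proof. by case. Qed.

HB.instance Definition _ := Finite.copy letter (can_type letter_codeK).

(* A set with an action of Z/7 * Z/2 such that the involution [bridge] has no
   fixed points; [step true] is the inverse of the rotation [step false]. *)
Record heptasystem : Type := Heptasystem {
  pt :> Type;
  step : bool -> pt -> pt;
  bridge : pt -> pt;
  stepK : forall t x, step (~~ t) (step t x) = x;
  step7 : forall t x, iter 7 (step t) x = x;
  bridgeK : involutive bridge;
  bridge_neq : forall x, bridge x <> x }.

Definition hflip (S : heptasystem) (d : S * slot) : S * slot :=
  if d.2 is Some t then (step t d.1, Some (~~ t)) else (bridge d.1, None).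

Lemma hflipK (S : heptasystem) (d : S * slot) : hflip (hflip d) = d.
Proof.
by case: d => x [t|]; rewrite /hflip /= ?stepK ?negbK ?bridgeK.
Qed.

Lemma hflip_neq (S : heptasystem) (d : S * slot) : hflip d <> d.
Proof.
by case: d => x [[]|] // [] /bridge_neq.
Qed.

Definition hcubic (S : heptasystem) : cubic := Cubic (@hflipK S) (@hflip_neq S).

Definition hgraph (S : heptasystem) : graph := cgraph (hcubic S).

Definition prism : heptasystem.
Proof.
refine (@Heptasystem (bool * pos)%type (fun t x => (x.1, pos_step t x.2))
  (fun x => (~~ x.1, x.2)) _ _ _ _).
- by move=> [] [b [[]|]].
- by move=> [] [b [[]|]].
- by move=> [[] i].
- by move=> [[] i].
Defined.

Inductive vert1 : Type := VA of bool | VB of bool | VC | VD.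

Definition vert1_code (v : vert1) : bool + bool + bool :=
  match v with
  | VA b => inl (inl b) | VB b => inl (inr b) | VC => inr true | VD => inr false
  end.

Definition vert1_decode (x : bool + bool + bool) : vert1 :=
  match x with
  | inl (inl b) => VA b | inl (inr b) => VB b | inr true => VC | inr false => VD
  end.

Lemma vert1_codeK : cancel vert1_code vert1_decode.
Proof. by case. Qed.

HB.instance Definition _ := Finite.copy vert1 (can_type vert1_codeK).

(** The vertices [VA] and [VB] span K4 minus the edge between the two [VB]; both [VB] are joined to
    [VC], and [VC] to [VD], which carries a loop. *)
Definition flip1 (d : vert1 * slot) : vert1 * slot :=
  match d with
  | (VA b, None) => (VA (~~ b), None)
  | (VA b, Some j) => (VB j, Some b)
  | (VB j, Some b) => (VA b, Some j)
  | (VB j, None) => (VC, Some j)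
  | (VC, Some j) => (VB j, None)
  | (VC, None) => (VD, None)
  | (VD, None) => (VC, None)
  | (VD, Some t) => (VD, Some (~~ t))
  end.

Lemma flip1K d : flip1 (flip1 d) = d.
Proof. by move: d => [[[]|[]||] [[]|]]. Qed.

Lemma flip1_neq d : flip1 d <> d.
Proof. by move: d => [[[]|[]||] [[]|]]. Qed.

Definition base1 : cubic := Cubic flip1K flip1_neq.

(* A Farkas certificate, found by linear programming, that no positive combination
   of closed reduced 7-walks uses the outgoing darts and their inverses equally. *)
Definition weight (d : vert1 * slot) : nat :=
  match d with
  | (VB _, Some _) => 5 | (VB _, None) => 4 | (VD, None) => 2 | _ => 0
  end.

Definition gains (os : seq (vert1 * slot)) : bool :=
  sumn [seq weight (flip1 o) | o <- os] < sumn [seq weight o | o <- os].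

Lemma heptagon_gains (d : base1 * slot) (ts : seq bool) :
  size ts = 7 -> run d ts = d -> gains (outs d ts).
Proof.
move=> sz_ts run_d.
pose P ts := ((run d ts : vert1 * slot) == d) ==> gains (outs d ts).
suff /all_turnsP/(_ _ sz_ts)/implyP : all_turns 7 P by apply; apply/eqP.
by rewrite {}/P; move: d {run_d} => [[[]|[]||] [[]|]]; vm_compute.
Qed.

Lemma heptagon_leaving (o : base1 * slot) :
  exists (d : base1 * slot) (ts : seq bool),
    [/\ size ts = 7, run d ts = d & last o (outs d ts) = o].
Proof.
(* The last turn leads back to [d], so the dart it leaves out has the source of [d]; hence [d] is
   sought among the darts at [o.1]. *)
pose P ts := has (fun s => ((run (o.1, s) ts : vert1 * slot) == (o.1, s)) &&
    ((last o (outs (o.1, s) ts) : vert1 * slot) == o)) [:: None; Some true; Some false].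
suff /has_turnsP[ts sz_ts /hasP[s _ /andP[/eqP run_s /eqP last_s]]] : has_turns 7 P.
  by exists (o.1, s), ts.
by rewrite {}/P; move: o => [[[]|[]||] [[]|]]; vm_compute.
Qed.

(** Decided by computation. By hand: bridges are crossed evenly often and never twice in a row, so
    four crossings need length 8, while two leave five steps, whose net rotation is odd and at most
    5 in size, hence nonzero mod 7. *)
Lemma prism_heptagon (d : hcubic prism * slot) (ts : seq bool) :
  size ts = 7 -> run d ts = d -> d.2 <> None.
Proof.
move=> sz_ts run_d.
pose P ts := ((run d ts : (bool * pos) * slot) == d) ==> (d.2 != None).
suff /all_turnsP/(_ _ sz_ts)/implyP H : all_turns 7 P by apply/eqP/H/eqP.
by rewrite {}/P; move: d {run_d} => [[[] [[]|]] [[]|]]; vm_compute.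
Qed.

(** * Coverings and equivariant maps *)

(** Local injectivity suffices, since an injective self-map of the three slots is bijective. *)
Lemma cubic_covering (c c' : cubic) (p : hom (cgraph c) (cgraph c')) :
  (forall y, exists x, vmap p x = y) ->
  (forall x, injective (fun s : slot => (dmap p (x, s)).2)) -> covering p.
Proof.
move=> p_surj p_inj; split=> [y _|x]; first by have [x <-] := p_surj y; exists x.
have dsrc s : (dmap p (x, s)).1 = vmap p x by exact: (dmap_src p (x, s)).
split=> [d <-|d d' /set_mem dx /set_mem d'x|[y s] /= yx].
- exact: dmap_src.
- rewrite (surjective_pairing d) (surjective_pairing d') [d.1]dx [d'.1]d'x => dd'.
  by congr pair; apply: (p_inj x); rewrite dd'.
- have [g _ gK] := injF_bij (p_inj x).
  exists (x, g s) => //=.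
  by rewrite [LHS]surjective_pairing dsrc (gK s) -yx.
Qed.

Lemma covering_inj (G H : graph) (p : hom G H) :
  covering p -> forall d d', src d = src d' -> dmap p d = dmap p d' -> d = d'.
Proof.
move=> [_ p_star] d d' dd'; have [_ p_inj _] := p_star (src d').
by apply: p_inj; apply/mem_set.
Qed.

Lemma covering_lift (G H : graph) (p : hom G H) :
  covering p -> forall (x : vert G) (e : dart H), src e = vmap p x ->
  exists2 d, src d = x & dmap p d = e.
Proof.
move=> [_ p_star] x e ex; have [_ _ p_surj] := p_star x.
by have [d dx de] := p_surj e ex; exists d.
Qed.

Lemma covering_surj (G H : graph) (p : hom G H) :
  covering p -> forall y, exists x, vmap p x = y.
Proof. by move=> [p_surj _] y; have [x _ <-] := p_surj y I; exists x. Qed.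

Definition equivariant (S S' : heptasystem) (f : S -> S') : Prop :=
  (forall t x, f (step t x) = step t (f x)) /\
  (forall x, f (bridge x) = bridge (f x)).

Definition hhom (S S' : heptasystem) (f : S -> S') (ef : equivariant f) :
  hom (hgraph S) (hgraph S').
Proof.
refine (@Hom (hgraph S) (hgraph S') f (fun d => (f d.1, d.2)) _ _) => // -[x [t|]] /=.
- by rewrite /hflip /= ef.1.
- by rewrite /hflip /= ef.2.
Defined.

Lemma hhom_covering (S S' : heptasystem) (f : S -> S') (ef : equivariant f) :
  (forall y, exists x, f x = y) -> covering (hhom ef).
Proof. by move=> f_surj; apply: cubic_covering => // x s s'. Qed.

Lemma equivariant_comp (S S' S'' : heptasystem) (f : S -> S') (g : S' -> S'') :
  equivariant f -> equivariant g -> equivariant (g \o f).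
Proof. by move=> [fs fb] [gs gb]; split=> [t x|x] /=; rewrite ?fs ?gs ?fb ?gb. Qed.

Definition hclosed (S : heptasystem) (P : S -> Prop) : Prop :=
  (forall t x, P x -> P (step t x)) /\ (forall x, P x -> P (bridge x)).

(** * The tree of heptagons *)

(* A vertex is [(b, s, i)] with [(b, s)] its heptagon and [i] its position there.
   The tree is rooted at the bridge joining the vertices [None] of the heptagons
   [(false, [::])] and [(true, [::])]; the children of [(b, s)] are the [(b, j :: s)]. *)
Definition tpt : Type := (bool * seq letter * pos)%type.

Definition tbridge (x : tpt) : tpt :=
  let: (b, s, i) := x in
  match i with
  | Some j => (b, j :: s, None)
  | None => if s is j :: s' then (b, s', Some j) else (~~ b, [::], None)
  end.

Definition tstep (t : bool) (x : tpt) : tpt := (x.1, pos_step t x.2).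

Definition heptatree : heptasystem.
Proof.
refine (@Heptasystem tpt tstep tbridge _ _ _ _).
- by move=> [] [a [[]|]].
- by move=> [] [a [[]|]].
- by move=> [[[] [|j s]] [i|]].
- by move=> [[[] [|j s]] [i|]].
Defined.

Definition troot : heptatree := (false, [::], None).

Lemma heptatree_ind (P : heptatree -> Prop) :
  hclosed P -> P troot -> forall x, P x.
Proof.
move=> [Ps Pb] P0.
have Pi a : P (a, None) -> forall i, P (a, i).
  move=> P1; have P2 := Ps false _ P1; have P3 := Ps false _ P2.
  have P4 := Ps false _ P3; have P5 := Ps false _ P4.
  have P6 := Ps false _ P5; have P7 := Ps false _ P6.
  by move=> [[]|].
suff PN b s : P (b, s, None) by move=> [[b s] i]; exact: Pi.
elim: s => [|j s IHs]; first by case: b => //; exact: (Pb _ P0).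
exact: (Pb (b, s, Some j) (Pi _ IHs _)).
Qed.

Lemma heptatree_ind_from (P : heptatree -> Prop) (x0 : heptatree) :
  hclosed P -> P x0 -> forall x, P x.
Proof.
move=> cP Px0; apply: heptatree_ind => //.
(* Induction on the base point, with [P] generalised: each generator is undone by another, so a
   closed [P] can be carried back to [troot]. *)
move: P cP Px0; pattern x0; apply: heptatree_ind => //; split.
  move=> t x IHx P cP Px; apply: IHx => //.
  by rewrite -(stepK t x); apply: cP.1.
by move=> x IHx P cP Px; apply: IHx => //; rewrite -(bridgeK x); apply: cP.2.
Qed.

Section Universal.
Variables (S : heptasystem) (x0 : S).

Fixpoint univ_base (b : bool) (s : seq letter) : S :=
  if s is j :: s' then bridge (iter (idx (Some j)) (step false) (univ_base b s'))
  else if b then bridge x0 else x0.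

(** The orbit map of [x0] under Z/7 * Z/2, which sends [troot] to [x0]. *)
Definition univ (x : heptatree) : S :=
  iter (idx x.2) (step false) (univ_base x.1.1 x.1.2).

Lemma univ_equivariant : equivariant univ.
Proof.
have univ_step x : univ (step false x) = step false (univ x).
  case: x => [[b s] [[]|]] //; rewrite /univ /=.
  by rewrite -[in LHS](step7 false (univ_base b s)).
split=> [[] x|[[b [|j s]] [i|]]] //.
- by rewrite -{2}(stepK true x) univ_step (stepK false).
- by rewrite /univ /=; case: b; rewrite //= bridgeK.
- by rewrite /univ /= bridgeK.
Qed.

End Universal.

Lemma equivariant_unique (S : heptasystem) (f g : heptatree -> S) (x0 : heptatree) :
  equivariant f -> equivariant g -> f x0 = g x0 -> f =1 g.
Proof.
move=> [fs fb] [gs gb] fg0; apply: (heptatree_ind_from (x0 := x0)) => //.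
by split=> [t x|x] fgx; rewrite ?fs ?gs ?fb ?gb fgx.
Qed.

Lemma equivariant_surj (f : heptatree -> heptatree) :
  equivariant f -> forall y, exists x, f x = y.
Proof.
move=> [fs fb]; apply: (heptatree_ind_from (x0 := f troot)); last by exists troot.
by split=> [t _ [x <-]|_ [x <-]]; [exists (step t x)|exists (bridge x)].
Qed.

(** The action on the tree is simply transitive. If [univ z] sends [w] to [troot], then
    [univ z \o univ w] fixes [troot] and is the identity by uniqueness, so [univ z] is
    invertible. *)
Lemma heptatree_homogeneous (x y : heptatree) :
  exists f : heptatree -> heptatree, [/\ equivariant f, bijective f & f x = y].
Proof.
have bij (z : heptatree) : bijective (univ z).
  have [w zw] := equivariant_surj (univ_equivariant z) troot.
  have zwK : univ z \o univ w =1 id.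
    by apply: (equivariant_unique (x0 := troot)) => //;
      apply: equivariant_comp; exact: univ_equivariant.
  have wzK : univ w \o univ z =1 id.
    move=> u; have [v <-] := equivariant_surj (univ_equivariant w) u.
    by rewrite /= [univ z (univ w v)]zwK.
  by exists (univ w).
have [g xK gK] := bij x; exists (univ y \o g); split.
- apply: equivariant_comp (univ_equivariant y); have [xs xb] := univ_equivariant x.
  by split=> [t u|u]; apply: (can_inj xK); rewrite ?xs ?xb !gK.
- by apply: bij_comp => //; exists (univ x).
- by rewrite /= -[x]/(univ x troot) xK.
Qed.

(** An equivariant bijection [g] moving [x] to [y] in the same fibre is a deck transformation:
    [f \o g] and [f] agree at [x], hence everywhere. *)
Lemma hhom_regular (S : heptasystem) (f : heptatree -> S) (ef : equivariant f) :
  regular (hhom ef).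
Proof.
have deck_move x y : f x = f y ->
    exists g (eg : equivariant g), deck (hhom ef) (hhom eg) /\ g x = y.
  move=> fxy; have [g [eg [g' gK g'K] gx]] := heptatree_homogeneous x y.
  have fg : f \o g =1 f.
    apply: (equivariant_unique (x0 := x)) => //; last by rewrite /= gx.
    exact: equivariant_comp.
  exists g, eg; split=> //; split.
  - split; first by exists g'.
    by exists (fun d => (g' d.1, d.2)) => -[z s]; rewrite /= ?gK ?g'K.
  - exact: fg.
  - by move=> [z s]; rewrite /= [f (g z)]fg.
split=> [x y /deck_move[g [eg [dg gx]]]|[x s] [y s'] /= [/deck_move[g [eg [dg gx]]] <-]].
  by exists (hhom eg).
by exists (hhom eg); rewrite //= gx.
Qed.

Definition prism_root : prism := (false, None).

Lemma prism_covering : covering (hhom (univ_equivariant prism_root)).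
Proof.
apply: hhom_covering; have [us _] := univ_equivariant prism_root => -[b i].
have [x xb] : exists x, univ prism_root x = (b, None).
  by case: b; [exists (true, [::], None)|exists troot].
exists (iter (idx i) (step false) x).
by case: i => [[]|]; rewrite /iter ?us xb.
Qed.

(** * Covering the base graph by the tree of heptagons *)

Lemma run_heptagon (c : cubic) (d : c * slot) (ts : seq bool) :
  size ts = 7 -> run d ts = d ->
  exists wo : (pos -> c * slot) * (pos -> c * slot),
    wo.2 None = last d (outs d ts) /\
    forall i, exists t, wo.1 (pos_next i) = turn t (flip (wo.1 i)) /\
                        wo.2 (pos_next i) = turn (~~ t) (flip (wo.1 i)).
Proof.
move=> sz_ts run_d.
(* Entry k of [outs] is left out on the turn into dart k+1 of the walk, hence the shift by
   [pos_prev]; position [None] receives the last entry. *)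
exists (fun i => run d (take (idx i) ts), fun i => nth d (outs d ts) (idx (pos_prev i))).
case: ts sz_ts run_d => [|t0 [|t1 [|t2 [|t3 [|t4 [|t5 [|t6 []]]]]]]] //= _ run_d.
split=> // -[[]|]; [exists t1|exists t2|exists t3|exists t4|exists t5|exists t6|exists t0];
  by rewrite //= run_d.
Qed.

Lemma heptagon_data (o : base1 * slot) :
  exists wo : (pos -> base1 * slot) * (pos -> base1 * slot),
    wo.2 None = o /\
    forall i, exists t, wo.1 (pos_next i) = turn t (flip (wo.1 i)) /\
                        wo.2 (pos_next i) = turn (~~ t) (flip (wo.1 i)).
Proof.
have [d [ts [sz_ts run_d last_o]]] := heptagon_leaving o.
have [wo [wo_None wo_next]] := run_heptagon sz_ts run_d.
exists wo; split=> //; rewrite wo_None -[RHS]last_o.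
by case: ts sz_ts {run_d last_o wo_None}.
Qed.

Definition ring_out (d : base1 * slot) := projT1 (choice heptagon_data) d.

Definition ring (d : base1 * slot) (i : pos) : base1 * slot := (ring_out d).1 i.
Definition out (d : base1 * slot) (i : pos) : base1 * slot := (ring_out d).2 i.

Lemma out_None d : out d None = d.
Proof. exact: (projT2 (choice heptagon_data) d).1. Qed.

Lemma ring_next d i : exists t, ring d (pos_next i) = turn t (flip (ring d i)) /\
                                out d (pos_next i) = turn (~~ t) (flip (ring d i)).
Proof. exact: (projT2 (choice heptagon_data) d).2. Qed.

(* [ring (entry a)] is the image of the heptagon [a]; [entry a] itself is the image
   of the bridge leaving [a] at its vertex [None]. *)
Fixpoint entry_at (b : bool) (s : seq letter) : base1 * slot :=
  if s is j :: s' then flip (out (entry_at b s') (Some j))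
  else if b then flip (VC : base1, None) else (VC : base1, None).

Definition entry (a : bool * seq letter) := entry_at a.1 a.2.

Definition cover1_dart (d : heptatree * slot) : base1 * slot :=
  match d.2 with
  | None => out (entry d.1.1) d.1.2
  | Some false => ring (entry d.1.1) d.1.2
  | Some true => flip (ring (entry d.1.1) (pos_prev d.1.2))
  end.

Lemma ring_out_spec d i : exists t,
  ring d i = turn t (flip (ring d (pos_prev i))) /\
  out d i = turn (~~ t) (flip (ring d (pos_prev i))).
Proof. by have := ring_next d (pos_prev i); rewrite pos_prevK. Qed.

Definition cover1_vert (x : heptatree) : base1 := (ring (entry x.1) x.2).1.

Definition cover1 : hom (hgraph heptatree) (cgraph base1).
Proof.
refine (@Hom (hgraph heptatree) (cgraph base1) cover1_vert cover1_dart _ _).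
- move=> [[a i] [[]|]] //=; have [t [r o]] := ring_out_spec (entry a) i;
    by rewrite /cover1_dart /cover1_vert /= ?o r.
- move=> [[[b s] i] [[]|]]; rewrite /hgraph /= /hflip /cover1_dart /=.
  + by rewrite flip1K.
  + by rewrite pos_nextK.
  + case: i s => [j|] [|j' s] /=; rewrite ?out_None /entry /= ?out_None ?flip1K //.
    by case: b => /=; rewrite ?flip1K.
Defined.

Lemma cover1_covering : covering cover1.
Proof.
have inj x : injective (fun s : slot => (dmap cover1 (x, s)).2).
  case: x => a i; have [t [r o]] := ring_out_spec (entry a) i.
  move=> [[]|] [[]|] //=; rewrite /cover1_dart /= ?r ?o /turn;
    by case: (flip1 _).2 => [[]|]; case: t {r o}.
apply: cubic_covering => //.
(* Local bijectivity makes the image closed under passing to neighbours, and [base1] is connected;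
   paths are routed through [VC]. *)
pose P (y : base1) := exists x, cover1_vert x = y.
have Pflip y s : P y -> P (flip1 (y, s)).1.
  move=> [x <-]; have [g _ gK] := injF_bij (inj x).
  have e : (cover1_vert x, s) = cover1_dart (x, g s).
    rewrite [RHS]surjective_pairing; congr pair; last by rewrite [RHS](gK s).
    by rewrite [RHS](dmap_src cover1 (x, g s)).
  exists (hflip (x, g s)).1; rewrite e.
  by rewrite -[LHS](dmap_src cover1 (hflip (x, g s))) [dmap _ _](dmap_rev cover1 (x, g s)).
have toC y : P y -> P VC.
  move: y => [b|b||] Py //.
  + exact: (Pflip (VB true) None (Pflip (VA b) (Some true) Py)).
  + exact: (Pflip (VB b) None Py).
  + exact: (Pflip VD None Py).
have PC : P VC by apply: (toC (cover1_vert troot)); exists troot.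
move=> [b|b||] //.
+ exact: (Pflip (VB true) (Some b) (Pflip VC (Some true) PC)).
+ exact: (Pflip VC (Some b) PC).
+ exact: (Pflip VC None PC).
Qed.

(** * Finite common quotients *)

Lemma run_turns (c : cubic) (e o : nat -> c * slot) :
  (forall k, exists t, e k.+1 = turn t (flip (e k)) /\ o k.+1 = turn (~~ t) (flip (e k))) ->
  forall n, exists ts,
    [/\ size ts = n, run (e 0) ts = e n & outs (e 0) ts = [seq o k | k <- iota 1 n]].
Proof.
move=> eo n; elim: n e o eo => [|n IHn] e o eo; first by exists [::].
have [t [e1 o1]] := eo 0.
have [ts [sz_ts run_ts outs_ts]] := IHn (e \o succn) (o \o succn) (fun k => eo k.+1).
exists (t :: ts); rewrite /= -e1 -o1 sz_ts run_ts outs_ts; split=> //.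
by rewrite (iotaDl 1 1) -map_comp.
Qed.

Definition hom_comp (G H K : graph) (p : hom G H) (p' : hom H K) : hom G K.
Proof.
refine (@Hom G K (vmap p' \o vmap p) (dmap p' \o dmap p) _ _) => e /=.
- by rewrite !dmap_src.
- by rewrite !dmap_rev.
Defined.

(** A locally injective map sends a heptagon of the tree to a closed reduced 7-walk, to which
    [prism_heptagon] applies. *)
Lemma prism_rigid (r : hom (hgraph heptatree) (hgraph prism)) :
  (forall d d', src d = src d' -> dmap r d = dmap r d' -> d = d') ->
  forall x t, (dmap r (x, Some t)).2 <> None.
Proof.
move=> r_inj.
have rF x : (dmap r (x, Some false)).2 <> None.
  pose e k := dmap r (iter k (step false) x, Some false).
  pose o k := dmap r (iter k (step false) x, None).
  have eo k : exists t, e k.+1 = turn t (hflip (e k)) /\ o k.+1 = turn (~~ t) (hflip (e k)).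
    have -> : hflip (e k) = dmap r (iter k.+1 (step false) x, Some true).
      by rewrite [RHS](dmap_rev r (iter k (step false) x, Some false)).
    apply: turnP.
    - by rewrite [LHS](dmap_src r (_, _)) [RHS](dmap_src r (_, _)).
    - by rewrite [LHS](dmap_src r (_, _)) [RHS](dmap_src r (_, _)).
    - by move/r_inj => /(_ erefl).
    - by move/r_inj => /(_ erefl).
    - by move/r_inj => /(_ erefl).
  have [ts [sz_ts run_ts _]] := run_turns (c := hcubic prism) eo 7.
  by apply: (prism_heptagon sz_ts); rewrite run_ts /e step7.
move=> x [] //; have := rF (step true x).
have -> : dmap r (x, Some true) = hflip (dmap r (step true x, Some false)).
  rewrite -[RHS](dmap_rev r (step true x, Some false)); congr (dmap r (_, _)).
  exact/esym/(stepK true x).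
by case: (dmap r _) => y [].
Qed.

(** The image of a heptagon cannot reverse: on arrival the dart leading back has slot [Some true],
    and the next one differs from it and is no bridge. *)
Lemma prism_direction (r : hom (hgraph heptatree) (hgraph prism)) :
  (forall d d', src d = src d' -> dmap r d = dmap r d' -> d = d') ->
  forall x, exists t, forall k, (dmap r (iter k (step t) x, Some t)).2 = Some false.
Proof.
move=> r_inj x; have r_ring := prism_rigid r_inj.
have [t rxt] : exists t, (dmap r (x, Some t)).2 = Some false.
  have := r_ring x false; have := r_ring x true.
  have := r_inj (x, Some true) (x, Some false) erefl.
  have := dmap_src r (x, Some true); have := dmap_src r (x, Some false).
  case Et: (dmap r (x, Some true)) => [z1 [[]|]];
    case Ef: (dmap r (x, Some false)) => [z2 [[]|]] //= -> ->.
  + by move/(_ erefl).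
  + by exists false; rewrite Ef.
  + by exists true; rewrite Et.
  + by exists true; rewrite Et.
exists t; elim=> [//|k]; rewrite iterS; set z := iter k _ _ => rz.
have rev_z : (dmap r (step t z, Some (~~ t))).2 = Some true.
  rewrite [dmap r _](dmap_rev r (z, Some t)) /= /hflip.
  by case: (dmap r (z, _)) rz => ? ? /= ->.
have := r_inj (step t z, Some t) (step t z, Some (~~ t)) erefl.
have := r_ring (step t z) t; move: rev_z.
have := dmap_src r (step t z, Some t); have := dmap_src r (step t z, Some (~~ t)).
case: (dmap r (_, Some (~~ t))) => z1 s1; case: (dmap r (_, Some t)) => z2 [[]|] //= -> -> ->.
by move=> _ /(_ erefl) []; case: (t).
Qed.

Lemma sum_reindex (T : eqType) (s : seq T) (f : T -> T) (g : T -> nat) :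
  uniq s -> (forall y, y \in s) -> injective f ->
  \sum_(y <- s) g (f y) = \sum_(y <- s) g y.
Proof.
move=> s_uniq s_all f_inj; rewrite -(big_map f xpredT g); apply: perm_big.
have fs_uniq : uniq (map f s) by rewrite map_inj_uniq.
apply: uniq_perm => //.
by have [|//|_] := @uniq_min_size _ (map f s) s fs_uniq; rewrite ?size_map.
Qed.

(** Double counting: [B] and all powers of [N] permute the finite set, so both sides have the same
    sum over [s]. *)
Lemma no_gain (T : eqType) (s : seq T) (N B : T -> T) (g : T -> nat) :
  uniq s -> (forall y, y \in s) -> inhabited T ->
  (forall y, iter 7 N y = y) -> involutive B ->
  ~ (forall y, sumn [seq g (B (iter k N y)) | k <- iota 1 7] <
               sumn [seq g (iter k N y) | k <- iota 1 7]).
Proof.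
move=> s_uniq s_all [y0] N7 BK lt_g.
have N_inj : injective N by move=> y z Nyz; rewrite -(N7 y) -(N7 z) !iterSr Nyz.
have iter_inj k : injective (iter k N).
  by elim: k => [|k IHk] y z //= /N_inj /IHk.
have sum_g h : \sum_(y <- s) sumn [seq h (iter k N y) | k <- iota 1 7] =
               \sum_(k <- iota 1 7) \sum_(y <- s) h y.
  under eq_bigr do rewrite sumnE big_map.
  rewrite exchange_big; apply: eq_bigr => k _; exact: sum_reindex.
have : \sum_(y <- s) sumn [seq g (B (iter k N y)) | k <- iota 1 7] <
       \sum_(y <- s) sumn [seq g (iter k N y) | k <- iota 1 7].
  rewrite !(perm_big _ (perm_to_rem (s_all y0))) !big_cons -addSn.
  by apply: leq_add; [exact: lt_g|apply: leq_sum => y _; exact/ltnW/lt_g].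
rewrite (sum_g (g \o B)) sum_g /= (sum_reindex (f := B)) ?ltnn //.
exact: inv_inj.
Qed.

(** Slots pulled back along [q2] give [Y] a rotation [N] and an involution [B]. Weights pulled back
    along [q1] to the bridges of [Y] then contradict [no_gain]. *)
Lemma no_finite_quotient (Y : graph) (q : hom (hgraph heptatree) Y)
  (q1 : hom Y (cgraph base1)) (q2 : hom Y (hgraph prism)) :
  finite_set [set: vert Y] -> covering q -> covering q1 -> covering q2 -> False.
Proof.
move=> Yfin cq cq1 cq2.
have [D DP] : {D : vert Y * slot -> dart Y |
    forall ys, src (D ys) = ys.1 /\ (dmap q2 (D ys)).2 = ys.2}.
  have [|D DP] := @choice (vert Y * slot)%type _
    (fun ys d => src d = ys.1 /\ (dmap q2 d).2 = ys.2); last by exists D.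
  move=> [y s].
  by have [|d dy ds] := covering_lift (x := y) (e := (vmap q2 y, s)) cq2; [|exists d; rewrite ds].
have srcD y s : src (D (y, s)) = y := (DP (y, s)).1.
have slotD y s : (dmap q2 (D (y, s))).2 = s := (DP (y, s)).2.
have D_uniq d s : (dmap q2 d).2 = s -> D (src d, s) = d.
  move=> ds; apply: (covering_inj cq2); rewrite ?srcD //.
  rewrite [LHS]surjective_pairing [RHS]surjective_pairing slotD ds.
  by rewrite ![(dmap q2 _).1](dmap_src q2 _) srcD.
pose N y := tgt (D (y, Some false)); pose B y := tgt (D (y, None)).
have revD y : Defs.rev (D (y, Some false)) = D (N y, Some true).
  apply/esym/D_uniq; rewrite dmap_rev /= /hflip.
  by have := slotD y (Some false); case: (dmap q2 _) => z _ /= ->.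
have bridgeD y : Defs.rev (D (y, None)) = D (B y, None).
  apply/esym/D_uniq; rewrite dmap_rev /= /hflip.
  by have := slotD y None; case: (dmap q2 _) => z _ /= ->.
have BK : involutive B by move=> y; rewrite {1}/B -bridgeD /tgt Defs.revK srcD.
pose r := hom_comp q q2.
have r_inj d d' : src d = src d' -> dmap r d = dmap r d' -> d = d'.
  move=> dd' /(covering_inj cq2); rewrite !dmap_src dd' => /(_ erefl).
  exact: covering_inj.
(* The orbit of [N] is the image of a heptagon of the tree, traversed in the direction given by
   [prism_direction]. *)
have N7 y : iter 7 N y = y.
  have [x <-] := covering_surj cq y.
  have [t rxk] := prism_direction r_inj x.
  have iterN k : iter k N (vmap q x) = vmap q (iter k (step t) x).
    elim: k => [//|k IHk]; rewrite !iterS IHk; set z := iter k _ x.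
    have qz : D (vmap q z, Some false) = dmap q (z, Some t).
      by rewrite -(rxk k) -/z -[vmap q z](dmap_src q (z, Some t)); apply: D_uniq.
    by rewrite /N qz /tgt -dmap_rev dmap_src.
  by rewrite iterN step7.
have /finite_seqP[s0 s0P] : finite_set [set: {classic (vert Y)}] := Yfin.
have s_all (y : {classic (vert Y)}) : y \in undup s0.
  by rewrite mem_undup; have : [set: {classic (vert Y)}] y by []; rewrite s0P.
pose g y := weight (dmap q1 (D (y, None))).
have Y0 : inhabited {classic (vert Y)} by split; exact: (vmap q troot).
apply: (@no_gain {classic (vert Y)} _ N B g (undup_uniq s0) s_all Y0 N7 BK) => y.
(* The orbit of [y] maps under [q1] to a closed reduced 7-walk [e], left by the images [o] of the
   bridges. *)
pose e k := dmap q1 (D (iter k N y, Some false)).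
pose o k := dmap q1 (D (iter k N y, None)).
have eo k : exists t, e k.+1 = turn t (flip1 (e k)) /\ o k.+1 = turn (~~ t) (flip1 (e k)).
  have -> : flip1 (e k) = dmap q1 (D (iter k.+1 N y, Some true)).
    by rewrite -[LHS](dmap_rev q1) revD.
  have D_neq z s s' : s <> s' -> dmap q1 (D (z, s)) <> dmap q1 (D (z, s')).
    move=> ss' /(covering_inj cq1); rewrite !srcD => /(_ erefl) DD'.
    by apply: ss'; rewrite -(slotD z s) DD' slotD.
  by apply: turnP; rewrite ?[(dmap q1 _).1](dmap_src q1 _) ?srcD //; apply: D_neq.
have [ts [sz_ts run_ts outs_ts]] := run_turns (c := base1) eo 7.
have e7 : e 7 = e 0 by rewrite /e N7.
have := heptagon_gains sz_ts (etrans run_ts e7); rewrite /gains outs_ts -!map_comp.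
congr (sumn _ < _); apply: eq_map => k.
by rewrite /= /o -[flip1 _](dmap_rev q1) bridgeD.
Qed.

(** * The tree of heptagons is a quasitree *)

Lemma walk_cat (G : graph) (u v w : vert G) s s' :
  walk u s v -> walk v s' w -> walk u (s ++ s') w.
Proof. by elim: s u => [u ->|e s IHs u [eu /IHs IH] /IH]. Qed.

Lemma walk_rcons (G : graph) (u v : vert G) s e :
  walk u (rcons s e) v -> walk u s (src e) /\ tgt e = v.
Proof.
elim: s u => [u [-> ->] //|e' s IHs u [e'u /IHs[we tv]]].
by split.
Qed.

Lemma dist_spec (G : graph) (u v : vert G) : (exists s, walk u s v) -> is_dist u v (dist u v).
Proof.
move=> [s0 ws0]; apply: xgetPex.
have ex_n : exists n, `[< exists2 s, walk u s v & size s = n >].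
  by exists (size s0); apply/asboolP; exists s0.
case: (ex_minnP ex_n) => n /asboolP ws n_min; exists n; split=> // s us.
by apply: n_min; apply/asboolP; exists s.
Qed.

Lemma dist_le_size (G : graph) (u v : vert G) s : walk u s v -> dist u v <= size s.
Proof. by move=> us; have [_] := dist_spec (ex_intro _ s us); apply. Qed.

Lemma heptatree_connected : connected (hgraph heptatree).
Proof.
split=> [|u v]; first by split; exact: troot.
move: v; apply: (heptatree_ind_from (x0 := u)); last by exists [::].
split=> [t x [s us]|x [s us]].
  by exists (s ++ [:: (x, Some t)]); apply: walk_cat us _.
by exists (s ++ [:: (x, None)]); apply: walk_cat us _.
Qed.

Lemma hgraph_locally_finite (S : heptasystem) : locally_finite (hgraph S).
Proof.
move=> x; apply: (@sub_finite_set _ _ (pair x @` [set: slot])).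
  by move=> [y s] /= <-; exists s.
exact/finite_image/finite_finset.
Qed.

(* Collapsing each heptagon to a point: the edges that survive are the bridges. *)
Definition polytree : graph :=
  @Graph (bool * seq letter)%type heptatree fst tbridge (@bridgeK heptatree)
    (@bridge_neq heptatree).

Lemma walk_collapse (u v : heptatree) (s : seq (dart (hgraph heptatree))) :
  walk (u : vert (hgraph heptatree)) s v ->
  exists2 s', walk (u.1 : vert polytree) s' v.1 & size s' <= size s.
Proof.
elim: s u => [u ->|[x [t|]] s IHs u [<- /IHs[s' ws' sz_s']]].
- by exists [::].
- by exists s' => //; apply: leqW.
- by exists (x :: s') => //=; split.
Qed.

Lemma heptagon_walk (a : bool * seq letter) (i j : pos) :
  exists2 s, walk ((a, i) : vert (hgraph heptatree)) s (a, j) & size s <= 6.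
Proof.
have [k k6 <-] : exists2 k, k <= 6 & iter k pos_next i = j.
  exists ((idx j + 7 - idx i) %% 7); first by rewrite -ltnS ltn_pmod.
  by case: i => [[]|]; case: j => [[]|].
have [s ws sz_s] : exists2 s, walk ((a, i) : vert (hgraph heptatree)) s (a, iter k pos_next i)
    & size s = k; last by exists s; rewrite ?sz_s.
elim: k {k6} i => [|k IHk] i; first by exists [::].
have [s ws sz_s] := IHk (pos_next i); rewrite iterSr.
by exists (((a, i), Some false) :: s); rewrite /= ?sz_s.
Qed.

(** Each bridge is preceded by at most 6 steps inside a heptagon, and at most 6 more follow the last
    bridge. *)
Lemma walk_expand (u v : heptatree) (s : seq (dart polytree)) :
  walk (u.1 : vert polytree) s v.1 ->
  exists2 s', walk (u : vert (hgraph heptatree)) s' v & size s' <= 7 * (size s).+1.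
Proof.
elim: s u => [[a i] /= au|x s IHs [a i] [xa /IHs[s' ws' sz_s']]].
  have [s' ws' sz_s'] := heptagon_walk a i v.2.
  by exists s'; [rewrite [v]surjective_pairing -au|rewrite muln1; apply: leqW].
have [s1 ws1 sz_s1] := heptagon_walk a i x.2.
exists (s1 ++ (x, None) :: s').
  apply: walk_cat ws1 _; split=> //.
  by rewrite [LHS]surjective_pairing; congr pair; exact: xa.
by rewrite size_cat /= addnS -addSn [7 * _.+2]mulnS leq_add.
Qed.

Lemma polytree_connected : connected polytree.
Proof.
split=> [|u v]; first by split; exact: (false, [::]).
have [_ /(_ (u, None) (v, None))[s /walk_collapse[s' ws' _]]] := heptatree_connected.
by exists s'.
Qed.

(** The distance from [(false, [::])], of which [(true, [::])] counts as a child; hence the boolean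
    is added as 0 or 1. *)
Definition depth (a : vert polytree) : nat := size a.2 + a.1.

Definition ascends (x : dart polytree) : bool := (x.2 == None) && (x.1 != (false, [::])).

Lemma ascends_depth x : ascends x -> depth (tgt x) < depth (src x).
Proof. by case: x => [[[] [|j s]] [i|]]. Qed.

Lemma descends_depth x : ~~ ascends x -> depth (tgt x) = (depth (src x)).+1.
Proof. by case: x => [[[] [|j s]] [i|]]. Qed.

Lemma descends_rev x : ~~ ascends x -> ascends (Defs.rev x).
Proof. by case: x => [[[] [|j s]] [i|]]. Qed.

Lemma ascends_inj x y : ascends x -> ascends y -> src x = src y -> x = y.
Proof. by case: x y => [a [i|]] [a' [i'|]] //= _ _ /= ->. Qed.

Lemma reduced_behead (G : graph) (e : dart G) s : reduced (e :: s) -> reduced s.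
Proof. by move=> re s1 e1 s2 es; apply: (re (e :: s1) e1 s2); rewrite es. Qed.

Lemma reduced_rcons (G : graph) (e : dart G) s : reduced (rcons s e) -> reduced s.
Proof.
move=> re s1 e1 s2 es; apply: (re s1 e1 (rcons s2 e)).
by rewrite es rcons_cat.
Qed.

(** The only ascending dart after a descending one is its reverse, which a reduced walk avoids. *)
Lemma descends_forever (x : dart polytree) s (u v : vert polytree) :
  walk u (x :: s) v -> reduced (x :: s) -> ~~ ascends x ->
  depth u < depth v /\ all (fun y => ~~ ascends y) (x :: s).
Proof.
elim: s x u => [|y s IHs] x u.
  by move=> [<- <-] _ dx; rewrite /= dx descends_depth.
move=> [<- w] rxy dx.
have dy : ~~ ascends y.
  apply/negP => ay; case: (rxy [::] x s); congr [:: _, _ & _].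
  by apply: ascends_inj (descends_rev dx) _ => //; have [-> _] := w.
have [lt_v des] := IHs y _ w (reduced_behead rxy) dy.
split; last exact/andP.
by apply: ltn_trans lt_v; rewrite descends_depth.
Qed.

Lemma ascends_until (x : dart polytree) s (u v : vert polytree) :
  walk u (rcons s x) v -> reduced (rcons s x) -> ascends x -> depth v < depth u.
Proof.
elim: s u => [|y s IHs] u; first by move=> [<- <-] _ /ascends_depth.
move=> wy ry ax; have [ay|dy] := boolP (ascends y); last first.
  have [_] := descends_forever wy ry dy.
  by rewrite -rcons_cons all_rcons ax.
case: wy => <- wy; apply: ltn_trans (IHs _ wy (reduced_behead ry) ax) _.
exact: ascends_depth.
Qed.

(** By depth, a nonempty closed reduced walk starts upwards and ends downwards, so its end darts are
    mutually inverse. The part between them is closed and reduced, hence empty by induction, which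
    leaves a backtrack. *)
Lemma polytree_tree : tree polytree.
Proof.
split=> [|v s]; first exact: polytree_connected.
have [n] := ubnP (size s); elim: n s v => // n IHn [//|e s] v sz_s ws rs.
have ae : ascends e.
  by apply/negPn/negP => /(descends_forever ws rs)[]; rewrite ltnn.
case/lastP: s sz_s ws rs => [|s e'] sz_s ws rs.
  by have := ascends_until (s := [::]) ws rs ae; rewrite ltnn.
have de' : ~~ ascends e'.
  apply/negP => ae'; have := ascends_until (s := e :: s) ws rs ae'.
  by rewrite ltnn.
have [ev /walk_rcons[ws' e'v]] := ws.
have ee' : e = Defs.rev e'.
  by apply: ascends_inj (descends_rev de') _ => //; rewrite ev -e'v.
have s0 : s = [::].
  apply: (IHn s (tgt e)); last exact: reduced_rcons (reduced_behead rs).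
    by move: sz_s; rewrite /= size_rcons !ltnS => /ltnW.
  by rewrite {2}ee' /tgt Defs.revK.
by case: (rs [::] e [::]); rewrite s0 ee' Defs.revK.
Qed.

Lemma heptatree_quasitree : quasitree (hgraph heptatree).
Proof.
split; [exact: heptatree_connected|exact: hgraph_locally_finite|].
exists polytree; split; first exact: polytree_tree.
(* Collapsing heptagons does not increase distances; the constants come from the bound
   [7 * (size s).+1] of [walk_expand]. *)
exists fst, 7, 1; split=> // [u v|u v|w].
- have [[s us <-] _] := dist_spec (heptatree_connected.2 u v).
  have [s' us' sz_s'] := walk_collapse us.
  apply: (leq_trans (dist_le_size us')); rewrite addn1; apply: leqW.
  by apply: leq_trans sz_s' _; rewrite leq_pmull.
- have [[s us <-] _] := dist_spec (polytree_connected.2 u.1 v.1).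
  have [s' us' sz_s'] := walk_expand us.
  by apply: (leq_trans (dist_le_size us')); rewrite addn1.
- by exists (w, None); apply: leqW; apply: (dist_le_size (s := [::])).
Qed.

Theorem theorem1p3 :
  exists (X X1 X2 : graph) (p1 : hom X X1) (p2 : hom X X2),
    quasitree X /\
    finite_graph X1 /\ finite_graph X2 /\
    covering p1 /\ covering p2 /\ regular p2 /\
    ~ (exists (Xhat : graph)
              (q : hom X Xhat) (q1 : hom Xhat X1) (q2 : hom Xhat X2),
         finite_graph Xhat /\ covering q /\ covering q1 /\ covering q2).
Proof.
exists (hgraph heptatree), (cgraph base1), (hgraph prism), cover1.
exists (hhom (univ_equivariant prism_root)).
split; first exact: heptatree_quasitree.
split; first by split; exact: finite_finset.
split; first by split; exact: finite_finset.
split; first exact: cover1_covering.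
split; first exact: prism_covering.
split; first exact: hhom_regular.
move=> [Y [q [q1 [q2 [[Yfin _] [cq [cq1 cq2]]]]]]].
exact: no_finite_quotient Yfin cq cq1 cq2.
Qed.
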